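(* Let $G$ be a graph of even order. Then $G$ is degree-equipartite if and only if $G$ is weakly equipartite.
   Context: All graphs are finite and simple (no loops, no multiple edges). The order of a graph $G$ is its number of vertices; $V(G)$ is its vertex set; for $A\subseteq V(G)$, $G[A]$ denotes the subgraph of $G$ induced by $A$. The degree sequence of a graph is the multiset of degrees of its vertices (equivalently, the degrees listed in sorted order). A graph $G$ of order $2n$ is called degree-equipartite if for every $n$-element set $A\subseteq V(G)$, the degree sequences of the induced subgraphs $G[A]$ and $G[V(G)\setminus A]$ are the same. A graph $G$ of order $2n$ is called weakly equipartite if for every partition of $V(G)$ into two sets $A$ and $B$ of $n$ vertices each, the subgraphs $G[A]$ and $G[B]$ are isomorphic. *)

(* Defs.v *)
From mathcomp Require Import all_boot.

Set Implicit Arguments.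
Unset Strict Implicit.
Unset Printing Implicit Defensive.

Record sgraph := SGraph {
  vertex : finType;
  adj : rel vertex;
  adj_sym : symmetric adj;
  adj_irrefl : irreflexive adj }.

Coercion vertex : sgraph >-> finType.

Definition gorder (G : sgraph) : nat := #|G|.

Definition degree (G : sgraph) (x : G) : nat := #|[set y : G | adj x y]|.

Definition degree_sequence (G : sgraph) : seq nat :=
  sort leq [seq degree x | x <- enum G].

Section Induced.
Variables (G : sgraph) (A : {set G}).

Definition induced_adj : rel {x : G | x \in A} :=
  fun u v => adj (val u) (val v).

Lemma induced_sym : symmetric induced_adj.
Proof. by move=> u v; apply: adj_sym. Qed.

Lemma induced_irrefl : irreflexive induced_adj.
Proof. by move=> u; apply: adj_irrefl. Qed.

Definition induced : sgraph := SGraph induced_sym induced_irrefl.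
End Induced.

Definition isomorphic (G H : sgraph) : Prop :=
  exists f : G -> H, bijective f /\ forall x y : G, adj (f x) (f y) = adj x y.

Definition degree_equipartite (G : sgraph) : Prop :=
  exists n : nat, gorder G = 2 * n /\
    forall A : {set G}, #|A| = n ->
      degree_sequence (induced A) = degree_sequence (induced (~: A)).

(* The parts are not required to be nonempty, so that n = 0 is allowed, which
   is why the library's [partition] is not used here. *)
Definition weakly_equipartite (G : sgraph) : Prop :=
  exists n : nat, gorder G = 2 * n /\
    forall A B : {set G}, A :|: B = [set: G] -> [disjoint A & B] ->
      #|A| = n -> #|B| = n -> isomorphic (induced A) (induced B).

(* Main.v *)
Require Import Defs.
From mathcomp Require Import all_boot all_algebra zify ring.

Set Implicit Arguments.
Unset Strict Implicit.
Unset Printing Implicit Defensive.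

(* Let G be degree-equipartite of order 2n.  If n <= 4, the two halves are
   isomorphic because a graph on at most four vertices is determined by its
   degree sequence.  Let n >= 5.  Comparing the degree sums of the halves shows
   that G is regular.  Comparing the sums of squared degrees shows that a cubic
   form vanishes on all balanced sign vectors; its third differences say that in
   every octahedron of vertices (three disjoint antipodal pairs) the
   non-monochromatic triangles, counted with alternating signs, cancel.  This
   local condition is restrictive: a finite search shows that ten vertices contain
   a monochromatic 5-set, and that, relative to a 5-clique, all vertices fall into
   at most two classes which differ from a complete graph or from two disjoint
   cliques only by a matching.  With regularity, G or its complement is K_2n,
   K_2n minus a perfect matching, 2 K_n or K_n x K_2.  In each case there is a
   fixed-point-free pairing s such that adjacency depends only on "being paired"
   and on "being in the same class", and the halves of such a graph are isomorphic:
   map x to s x when s x lies in the other half, and match the pairs contained in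
   one half with the equally many pairs contained in the other. *)

(** * Local search for graphs with the octahedral property *)

(** Read on edge colours: the triangle is not monochromatic. *)
Definition mixed (a b c : bool) : bool := (a (+) b) || (a (+) c).

(* The triangles of the octahedron with antipodal pairs [(xi, yi)], split by the
   parity of the number of [yi] they contain. *)
Definition balanced6 (T : Type) (e : rel T) (x1 y1 x2 y2 x3 y3 : T) : bool :=
  let a := e x1 x2 in let a' := e x1 y2 in let b := e y1 x2 in let b' := e y1 y2 in
  let c := e x1 x3 in let c' := e x1 y3 in let d := e y1 x3 in let d' := e y1 y3 in
  let f := e x2 x3 in let f' := e x2 y3 in let g := e y2 x3 in let g' := e y2 y3 in
  mixed a c f + mixed a' c' g' + mixed b d' f' + mixed b' d g ==
  mixed b' d' g' + mixed b d f + mixed a' c g + mixed a c' f'.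

Definition octahedral (T : eqType) (e : rel T) : Prop :=
  forall x1 y1 x2 y2 x3 y3 : T, uniq [:: x1; y1; x2; y2; x3; y3] ->
    balanced6 e x1 y1 x2 y2 x3 y3.

Notation boolmx := (seq bitseq).

Definition code (T : Type) (e : rel T) (xs : seq T) : boolmx :=
  [seq [seq e x y | y <- xs] | x <- xs].

Definition entry (m : boolmx) : rel nat := fun i j => nth false (nth [::] m i) j.

(** The new vertex takes index 0, so a clique chosen at the start keeps the last indices. *)
Definition extend (r : bitseq) (m : boolmx) : boolmx :=
  (false :: r) :: [seq p.1 :: p.2 | p <- zip r m].

Fixpoint bitseqs (n : nat) : seq bitseq :=
  if n is n'.+1 then map (cons true) (bitseqs n') ++ map (cons false) (bitseqs n')
  else [:: [::]].

(* Unlike [all], this stops at the first failure under call-by-value too. *)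
Fixpoint all_lazy (T : Type) (p : pred T) (s : seq T) : bool :=
  if s is x :: s' then if p x then all_lazy p s' else false else true.

Definition balanced6_code (m : boolmx) (t : seq nat) : bool :=
  if t is [:: i1; j1; i2; j2; i3; j3] then balanced6 (entry m) i1 j1 i2 j2 i3 j3
  else true.

(** Only octahedra through index 0, the newest vertex: the others were tested when their own newest
    vertex was added. Soundness does not rest on completeness of this list. *)
Definition octahedra (n : nat) : seq (seq nat) :=
  let pairs := [seq (i, j) | i <- iota 1 n.-1, j <- iota i.+1 (n.-1 - i)] in
  let pairings := [seq (p, q) | p <- pairs, q <- [seq q <- pairs | p.1 < q.1]] in
  [seq t <- [seq [:: 0; j; pq.1.1; pq.1.2; pq.2.1; pq.2.2] |
              j <- rev (iota 1 n.-1), pq <- pairings] | uniq t].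

(** Testing that [t] holds tuples of distinct indices in range is part of the computation, which
    spares [all_extensionsP] a hypothesis on [t]. *)
Definition all_extensions (t : seq (seq nat)) (P : pred boolmx) (m : boolmx) : bool :=
  if all (fun u => uniq u && all (fun i => i < (size m).+1) u) t then
    all_lazy (fun r => let m' := extend r m in
      if all_lazy (balanced6_code m') t then P m' else true) (bitseqs (size m))
  else false.

Definition mono5 (m : boolmx) : bool :=
  let e := entry m in
  let s := [seq mask b (iota 0 (size m)) | b <- bitseqs (size m) & count id b == 5] in
  has (fun u => pairwise e u || pairwise (fun i j => ~~ e i j) u) s.

(** A monochromatic 5-set ends the branch; [if] keeps call-by-value from evaluating the rest. *)
Definition until_mono5 (P : pred boolmx) (m : boolmx) : bool :=
  if mono5 m then true else P m.

Definition dominated (P : pred boolmx) (m : boolmx) : bool :=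
  if all id (behead (head [::] m)) then P m else true.

(* The sixth vertex is chosen adjacent to the first five, which are arbitrary. *)
Definition mono5_check : bool :=
  let t6 := octahedra 6 in let t7 := octahedra 7 in
  let t8 := octahedra 8 in let t9 := octahedra 9 in
  iter 5 (all_extensions [::]) (all_extensions t6 (dominated (until_mono5
    (all_extensions t7 (until_mono5 (all_extensions t8 (until_mono5
      (all_extensions t9 mono5)))))))) [::].

(* The reference 5-clique occupies the last five indices. *)
Definition far5 (m : boolmx) (i : nat) : bool :=
  4 <= count (fun j => ~~ entry m i j) (iota (size m - 5) 5).

(* The predicate [b] tells the second class of vertices from the first, which
   contains the reference 5-clique.  The last clause isolates the exceptional case
   of a clique plus two isolated vertices, which is not regular. *)
Definition triple_ok (T : Type) (e : rel T) (b : pred T) (x y z : T) : bool :=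
  [&& ~~ [&& b x == b y, b x == b z, ~~ e x y & ~~ e x z],
      ~~ [&& b x != b y, b y == b z, e x y & e x z],
      [&& ~~ b x, ~~ b y & b z] ==> e x y &
      [&& b x, b y & ~~ e x y] ==> ~~ e x z].

Definition triples_ok (ts : seq (seq nat)) (m : boolmx) : bool :=
  all (fun t => if t is [:: x; y; z] then triple_ok (entry m) (far5 m) x y z else true) ts.

(** Each triple is examined over the clique and its own members outside it, which get the indices
    below [d]; hence at most three vertices are ever added. *)
Definition triples (d : nat) : seq (seq nat) :=
  [seq t <- [seq i :: t | i <- iota 0 (5 + d),
              t <- [seq [:: j; k] | j <- iota 0 (5 + d), k <- iota 0 (5 + d)]] |
    uniq t && all (fun i => i \in t) (iota 0 d)].

Definition triples_check : bool :=
  let t6 := octahedra 6 in let t7 := octahedra 7 in let t8 := octahedra 8 in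
  let m := [seq [seq i != j | j <- iota 0 5] | i <- iota 0 5] in
  [&& triples_ok (triples 0) m,
      all_extensions t6 (triples_ok (triples 1)) m,
      all_extensions t6 (all_extensions t7 (triples_ok (triples 2))) m &
      all_extensions t6 (all_extensions t7 (all_extensions t8 (triples_ok (triples 3)))) m].

(** * Soundness of the search *)

Lemma all_lazyE (T : Type) (p : pred T) (s : seq T) : all_lazy p s = all p s.
Proof. by elim: s => //= x s ->; case: (p x). Qed.

Lemma size_bitseqs (n : nat) : {in bitseqs n, forall r, size r = n}.
Proof.
elim: n => [|n IHn] r /=; first by rewrite inE => /eqP->.
by rewrite mem_cat => /orP[] /mapP[r' /IHn <- ->].
Qed.

Lemma mem_bitseqs (r : bitseq) : r \in bitseqs (size r).
Proof.
elim: r => [|[] r IHr] //=; rewrite mem_cat map_f // orbT //.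
Qed.

Lemma lt_size_fresh (T : finType) (s : seq T) : size s < #|T| -> exists x, x \notin s.
Proof.
move=> lt_s; apply/existsP; apply: contraLR lt_s; rewrite negb_exists => /forallP all_s.
rewrite -leqNgt; apply: leq_trans (card_size s); apply: subset_leq_card.
by apply/subsetP => x _; have := all_s x; rewrite negbK.
Qed.

Section Codes.
Variables (T : eqType) (e : rel T).
Hypotheses (e_sym : symmetric e) (e_irr : irreflexive e) (e_oct : octahedral e).

Lemma size_code (xs : seq T) : size (code e xs) = size xs.
Proof. by rewrite size_map. Qed.

Lemma entry_code (x0 : T) (xs : seq T) (i j : nat) :
  i < size xs -> j < size xs -> entry (code e xs) i j = e (nth x0 xs i) (nth x0 xs j).
Proof. by move=> ltis ltjs; rewrite /entry (nth_map x0) // (nth_map x0). Qed.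

Lemma code_cons (x : T) (xs : seq T) :
  code e (x :: xs) = extend [seq e x y | y <- xs] (code e xs).
Proof.
rewrite /code /extend /= e_irr zip_map -map_comp; congr (_ :: _).
by apply: eq_map => y /=; rewrite e_sym.
Qed.

(** The actual row of [x] is one of the enumerated bit sequences, and [e_oct] makes it pass every
    test in [t], so the search reaches the actual matrix. *)
Lemma all_extensionsP (t : seq (seq nat)) (P : pred boolmx) (x : T) (xs : seq T) :
  all_extensions t P (code e xs) -> uniq (x :: xs) -> P (code e (x :: xs)).
Proof.
rewrite /all_extensions; case: ifP => // t_ok; rewrite all_lazyE => /allP.
have r_in : [seq e x y | y <- xs] \in bitseqs (size (code e xs)).
  by rewrite size_code -(size_map (e x) xs) mem_bitseqs.
move=> /(_ _ r_in) /=; rewrite -code_cons all_lazyE => + uniq_xs.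
suff -> : all (balanced6_code (code e (x :: xs))) t by [].
apply/allP => u /(allP t_ok); rewrite size_code -[(size xs).+1]/(size (x :: xs)).
case: u => [|i1 [|j1 [|i2 [|j2 [|i3 [|j3 [|]]]]]]] //= /andP[uniq_u].
rewrite andbT => /and5P[lti1 ltj1 lti2 ltj2 /andP[lti3 ltj3]].
have := e_oct (x1 := nth x (x :: xs) i1) (y1 := nth x (x :: xs) j1)
  (x2 := nth x (x :: xs) i2) (y2 := nth x (x :: xs) j2)
  (x3 := nth x (x :: xs) i3) (y3 := nth x (x :: xs) j3).
rewrite /balanced6 !(entry_code x) //; apply.
rewrite -[[:: _; _; _; _; _; _]]/[seq nth x (x :: xs) i | i <- [:: i1; j1; i2; j2; i3; j3]].
rewrite map_inj_in_uniq ?uniq_u // => i j i_in j_in /eqP.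
have lt_in k : k \in [:: i1; j1; i2; j2; i3; j3] -> k < size (x :: xs).
  by rewrite !inE => /or4P[/eqP->|/eqP->|/eqP->|/or3P[]/eqP->].
by rewrite nth_uniq ?lt_in // => /eqP.
Qed.

Definition mono_clique (K : seq T) : bool :=
  [&& uniq K, size K == 5 & pairwise e K || pairwise (fun x y => ~~ e x y) K].

Lemma mono5P (xs : seq T) :
  uniq xs -> mono5 (code e xs) -> exists K, mono_clique K.
Proof.
case: xs => [|x0 xs'] //; set xs := x0 :: xs' => uniq_xs.
rewrite /mono5 size_code => /hasP[u /mapP[b]].
rewrite mem_filter => /andP[/eqP b5 /size_bitseqs size_b] -> mono_u.
set v := mask b (iota 0 (size xs)) in mono_u *.
have v_lt : all (fun i => i < size xs) v.
  by apply/allP => i /mem_mask; rewrite mem_iota.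
exists [seq nth x0 xs i | i <- v]; rewrite /mono_clique size_map size_mask ?size_iota // b5 eqxx.
rewrite map_inj_in_uniq ?mask_uniq ?iota_uniq //=; last first.
  move=> i j /(allP v_lt) lti /(allP v_lt) ltj /eqP.
  by rewrite nth_uniq // => /eqP.
case/orP: mono_u => mono_v; rewrite !pairwise_map; apply/orP; [left | right];
  by apply: sub_in_pairwise v_lt mono_v => i j lti ltj /=; rewrite (entry_code x0).
Qed.

Lemma until_mono5P (P : pred boolmx) (xs : seq T) : uniq xs ->
  until_mono5 P (code e xs) -> (exists K, mono_clique K) \/ P (code e xs).
Proof.
by move=> uniq_xs; rewrite /until_mono5; case: ifP => [/mono5P|]; [left; auto | right].
Qed.
End Codes.

(** The cast is left unchecked by the tactic, so the search runs only once, in the kernel at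
    [Qed]. *)
Lemma mono5_checkE : mono5_check.
Proof. by vm_cast_no_check (erefl true). Qed.

Lemma triples_checkE : triples_check.
Proof. by vm_cast_no_check (erefl true). Qed.

Section Finite.
Variables (T : finType) (e : rel T).
Hypotheses (e_sym : symmetric e) (e_irr : irreflexive e) (e_oct : octahedral e).

Lemma dominated_mono_clique (v : T) (us : seq T) :
  8 < #|T| -> uniq (v :: us) -> size us = 5 -> all (e v) us ->
  exists K, mono_clique e K.
Proof.
move=> ltT uniq_vus; case: us uniq_vus => [|u1 [|u2 [|u3 [|u4 [|u5 [|]]]]]] // uniq6 _ e_v.
have ext t P x xs := @all_extensionsP _ _ e_sym e_irr e_oct t P x xs.
have fresh (xs : seq T) : uniq xs -> size xs < 9 -> exists x, uniq (x :: xs).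
  move=> uniq_xs lt_xs; have [x x_notin] := lt_size_fresh (leq_trans lt_xs ltT).
  by exists x; rewrite /= x_notin.
have := mono5_checkE; rewrite /mono5_check; cbv zeta.
set P := all_extensions (octahedra 6) _.
rewrite !iterS.
have [_ uniq5] := andP uniq6; have [_ uniq4] := andP uniq5.
have [_ uniq3] := andP uniq4; have [_ uniq2] := andP uniq3.
(* The vertices enter in the order [u5], ..., [u1], [v], so [v] has index 0 when [dominated]
   inspects the first row. *)
move=> /(ext _ _ u5 [::])/(_ isT)/ext/(_ uniq2)/ext/(_ uniq3)/ext/(_ uniq4)/ext/(_ uniq5)/ext/(_ uniq6).
rewrite /dominated ifT; last by rewrite /= andbT; move: e_v => /= ; rewrite andbT.
case/(until_mono5P uniq6) => //.
have [x7 uniq7] := fresh _ uniq6 isT.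
move=> /ext/(_ uniq7)/(until_mono5P uniq7)[] //.
have [x8 uniq8] := fresh _ uniq7 isT.
move=> /ext/(_ uniq8)/(until_mono5P uniq8)[] //.
have [x9 uniq9] := fresh _ uniq8 isT.
by move=> /ext/(_ uniq9)/(mono5P uniq9).
Qed.

Definition far (K : seq T) (x : T) : bool := 4 <= count (fun y => ~~ e x y) K.

Lemma triples_ok_code (K ys : seq T) : uniq (ys ++ K) -> size K = 5 -> pairwise e K ->
  size ys <= 3 -> triples_ok (triples (size ys)) (code e (ys ++ K)).
Proof.
move=> uniq_ysK sz_K K_clique.
have ext t P x xs := @all_extensionsP _ _ e_sym e_irr e_oct t P x xs.
have := triples_checkE; rewrite /triples_check; cbv zeta.
have <- : code e K = [seq [seq i != j | j <- iota 0 5] | i <- iota 0 5].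
  case: K sz_K K_clique {uniq_ysK} => [|a [|b [|c [|d [|f [|]]]]]] //= _.
  rewrite /code /= !e_irr !andbT.
  case/and4P => /and4P[ab ac ad af] /and3P[bc bd bf] /andP[cd cf] df.
  rewrite (e_sym b a) !(e_sym c a, e_sym c b) !(e_sym d a, e_sym d b, e_sym d c).
  by rewrite (e_sym f a) (e_sym f b) (e_sym f c) (e_sym f d) ab ac ad af bc bd bf cd cf df.
case/and4P=> S0 S1 S2 S3.
case: ys uniq_ysK => [|x [|y [|z [|w ys]]]] uniq_ysK lt3; last by [].
- exact: S0.
- exact: ext S1 uniq_ysK.
- by have [_ uniq_yK] := andP uniq_ysK; exact: ext (ext _ _ _ _ S2 uniq_yK) uniq_ysK.
have [_ uniq_yzK] := andP uniq_ysK; have [_ uniq_zK] := andP uniq_yzK.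
exact: ext (ext _ _ _ _ (ext _ _ _ _ S3 uniq_zK) uniq_yzK) uniq_ysK.
Qed.

Lemma far5_code (K ys : seq T) (x0 : T) (i : nat) : size K = 5 -> i < size (ys ++ K) ->
  far5 (code e (ys ++ K)) i = far K (nth x0 (ys ++ K) i).
Proof.
move=> sz_K lt_i; rewrite /far5 /far; congr (_ <= _).
set z := nth x0 _ i.
have KE : K = [seq nth x0 (ys ++ K) j | j <- iota (size ys) 5].
  apply: (@eq_from_nth _ x0); rewrite ?size_map ?size_iota // sz_K => j lt_j.
  rewrite (nth_map 0) ?size_iota // nth_iota // nth_cat ltnNge leq_addr /=.
  by rewrite addKn.
rewrite [in RHS](congr1 (count _) KE) count_map size_code size_cat sz_K addnK; apply: eq_in_count => j.
rewrite mem_iota => /andP[_ lt_j] /=; by rewrite (entry_code e x0 lt_i) // size_cat sz_K.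
Qed.

(** List the members of the triple outside [K] in front of [K]. The positions of [x], [y], [z] in
    this list then form one of the triples covered by [triples_check]. *)
Lemma clique_triple_ok (K : seq T) (x y z : T) :
  uniq K -> size K = 5 -> pairwise e K -> uniq [:: x; y; z] -> triple_ok e (far K) x y z.
Proof.
move=> uniq_K sz_K K_clique uniq_xyz.
set ys := [seq v <- [:: x; y; z] | v \notin K].
have uniq_ysK : uniq (ys ++ K).
  rewrite cat_uniq filter_uniq //= uniq_K andbT; apply/hasPn => v vK.
  by rewrite mem_filter vK.
have sz_ys : size ys <= 3 by rewrite size_filter count_size.
set zs := ys ++ K in uniq_ysK.
have sub_zs v : v \in [:: x; y; z] -> v \in zs.
  by move=> v_in; rewrite mem_cat mem_filter v_in andbT; case: (v \in K).
have sub_ys v : v \in ys -> v \in [:: x; y; z] by rewrite mem_filter => /andP[].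
have sz_zs : size zs = 5 + size ys by rewrite size_cat sz_K addnC.
pose ix v := index v zs.
have lt_ix v : v \in [:: x; y; z] -> ix v < size zs by rewrite index_mem; apply: sub_zs.
have [x_in y_in z_in] : [/\ x \in [:: x; y; z], y \in [:: x; y; z] & z \in [:: x; y; z]].
  by rewrite !inE !eqxx !orbT.
have := triples_ok_code uniq_ysK sz_K K_clique sz_ys; rewrite -/zs.
have t_in : [:: ix x; ix y; ix z] \in triples (size ys).
  rewrite mem_filter; apply/andP; split; last first.
    by rewrite -sz_zs !(allpairs_f, mem_iota) //; apply: lt_ix.
  apply/andP; split.
    rewrite -[[:: _; _; _]]/(map ix [:: x; y; z]) map_inj_in_uniq // => u v u_in v_in.
    by apply: (index_inj x); apply: sub_zs.
  apply/allP => i; rewrite mem_iota => /= lt_i.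
  rewrite -[[:: _; _; _]]/(map ix [:: x; y; z]); apply/mapP; exists (nth x zs i).
    by apply: sub_ys; rewrite nth_cat lt_i mem_nth.
  by rewrite /ix index_uniq // sz_zs (leq_trans lt_i) ?leq_addl.
move=> /allP/(_ _ t_in); rewrite /triple_ok !(entry_code e x) ?lt_ix //.
by rewrite !(far5_code x) ?lt_ix // !nth_index ?sub_zs.
Qed.
End Finite.

(** * Global structure *)

Definition complement (T : eqType) (e : rel T) : rel T := fun x y => (x != y) && ~~ e x y.

Lemma complement_sym (T : eqType) (e : rel T) : symmetric e -> symmetric (complement e).
Proof. by move=> e_sym x y; rewrite /complement eq_sym e_sym. Qed.

Lemma complement_irr (T : eqType) (e : rel T) : irreflexive (complement e).
Proof. by move=> x; rewrite /complement eqxx. Qed.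

Lemma complement_octahedral (T : eqType) (e : rel T) :
  octahedral e -> octahedral (complement e).
Proof.
move=> e_oct x1 y1 x2 y2 x3 y3 uniq6; have := e_oct _ _ _ _ _ _ uniq6.
have mixedN a b c : mixed (~~ a) (~~ b) (~~ c) = mixed a b c by case: a; case: b; case: c.
move: uniq6; rewrite /= !inE !negb_or -!andbA andbT.
repeat (case/andP=> ?); move=> ?.
rewrite /balanced6 /complement.
repeat match goal with H : is_true (?x != ?y) |- _ => rewrite H /=; clear H end.
by rewrite !mixedN.
Qed.

Definition nbhd (T : finType) (e : rel T) (x : T) : {set T} := [set y | e x y].

Lemma card_nbhd_complement (T : finType) (e : rel T) (x : T) : irreflexive e ->
  #|nbhd e x| + #|nbhd (complement e) x| = #|T|.-1.
Proof.
move=> e_irr; rewrite -[#|T|]cardsT (cardsD1 x setT) in_setT add1n -(cardsID (nbhd e x) (setT :\ x)).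
congr (_ + _); apply: eq_card => y; rewrite !inE /complement.
  by case: eqP => [->|]; rewrite ?e_irr.
by rewrite andbT andbC eq_sym.
Qed.

(** Among at least ten vertices, any vertex has five neighbours or five non-neighbours;
    [dominated_mono_clique] applies to the graph or to its complement. *)
Lemma ramsey5 (T : finType) (e : rel T) :
  symmetric e -> irreflexive e -> octahedral e -> 9 < #|T| ->
  exists K, mono_clique e K.
Proof.
move=> e_sym e_irr e_oct ltT.
have nbhd5 f (v : T) : symmetric f -> irreflexive f -> octahedral f -> 4 < #|nbhd f v| ->
    exists K, mono_clique f K.
  move=> f_sym f_irr f_oct lt_v; pose us := take 5 (enum (nbhd f v)).
  have us_v u : u \in us -> f v u by move/mem_take; rewrite mem_enum inE.
  apply: (dominated_mono_clique f_sym f_irr f_oct (v := v) (us := us)).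
  - exact: ltnW.
  - rewrite /= take_uniq ?enum_uniq // andbT.
    by apply/negP => /us_v; rewrite f_irr.
  - by rewrite size_takel // -cardE.
  - by apply/allP.
have [v _] : exists v : T, v \notin [::] by apply: lt_size_fresh; exact: leq_trans ltT.
have := card_nbhd_complement v e_irr.
have [lt_v _|ge_v eqT] := ltnP 4 #|nbhd e v|; first exact: nbhd5 lt_v.
have [K /and3P[uniq_K sz_K mono_K]] : exists K, mono_clique (complement e) K.
  apply: (nbhd5 _ v); [exact: complement_sym | exact: complement_irr | exact: complement_octahedral |].
  by move: ltT; lia.
(* The two colours trade places; distinctness of the members of [K] turns non-edges of the
   complement into edges. *)
exists K; rewrite /mono_clique uniq_K sz_K /= orbC.
case/orP: mono_K => mono_K; apply/orP; [left | right].
  by apply: sub_pairwise mono_K => x y /andP[].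
move: mono_K; rewrite uniq_pairwise in uniq_K; move=> mono_K.
have: pairwise (fun x y => (x != y) && ~~ complement e x y) K.
  by rewrite pairwise_relI uniq_K.
by apply: sub_pairwise => x y /andP[xy]; rewrite /complement xy /= negbK.
Qed.

(** The condition on [b] makes [s] fixed-point free and the two classes equal in size. When [q = r],
    [b] merely orients the pairs. *)
Definition paired (T : finType) (e : rel T) : Prop :=
  exists (s : T -> T) (b : pred T) (p q r : bool),
    [/\ involutive s, forall x, b (s x) = ~~ b x
      & forall x y, x != y ->
          e x y = if y == s x then p else if b x == b y then q else r].

Lemma complement_paired (T : finType) (e : rel T) : paired (complement e) -> paired e.
Proof.
move=> [s [b [p [q [r [sK bs eE]]]]]]; exists s, b, (~~ p), (~~ q), (~~ r); split=> // x y xy.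
have := eE x y xy; rewrite /complement xy /= => /negbRL ->.
by case: ifP => // _; case: ifP.
Qed.

(** The involution exchanges the k-th vertex of one class with the k-th vertex of the other, in the
    order of [enum]. *)
Lemma swap_involution (T : finType) (b : pred T) : #|b| = #|predC b| ->
  exists2 s : T -> T, involutive s & forall x, b (s x) = ~~ b x.
Proof.
move=> cardb.
pose s x := if b x then nth x (enum (predC b)) (index x (enum b))
            else nth x (enum b) (index x (enum (predC b))).
have bs x : b (s x) = ~~ b x.
  rewrite /s; case: ifP => bx.
    apply/negbTE; change (nth x (enum (predC b)) (index x (enum b)) \in predC b).
    by rewrite -mem_enum mem_nth // -cardE -cardb cardE index_mem mem_enum.
  change (nth x (enum b) (index x (enum (predC b))) \in b).
  by rewrite -mem_enum mem_nth // -cardE cardb cardE index_mem mem_enum inE /= bx.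
have cardb' : size (enum (predC b)) = size (enum b) by rewrite -!cardE.
exists s => // x; have := bs x; rewrite {2 3}/s => ->.
case bx: (b x) => /=.
  rewrite index_uniq ?enum_uniq ?cardb' ?index_mem ?mem_enum //.
  by rewrite nth_index // mem_enum.
rewrite index_uniq ?enum_uniq -?cardb' ?index_mem ?mem_enum ?inE /= ?bx //.
by rewrite nth_index // mem_enum inE /= bx.
Qed.

Lemma half_pred (T : finType) (n : nat) : #|T| = n.*2 ->
  exists b : pred T, #|b| = #|predC b|.
Proof.
move=> cardT; exists (mem (take n (enum T))).
have cardb : #|mem (take n (enum T))| = n.
  apply: etrans (card_uniqP (take_uniq n (enum_uniq T))) _.
  by rewrite size_takel // -cardE cardT -addnn leq_addr.
have := cardC (mem (take n (enum T))); rewrite cardb cardT -addnn => /addnI ->.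
by [].
Qed.

(* Ordering the vertices turns a matching into an orientation of its pairs. *)
Lemma involution_orientation (T : finType) (s : T -> T) :
  involutive s -> (forall x, s x != x) -> exists b : pred T, forall x, b (s x) = ~~ b x.
Proof.
move=> sK s_fix; exists (fun x => enum_rank x < enum_rank (s x)) => x.
rewrite sK -leqNgt ltn_neqAle; suff -> : enum_rank (s x) != enum_rank x :> nat by [].
by rewrite (inj_eq val_inj) (inj_eq enum_rank_inj).
Qed.

(** * Regular graphs close to one clique or to two cliques *)

Section Structure.
Variables (T : finType) (n : nat) (e : rel T).
Hypotheses (cardT : #|T| = n.*2) (e_sym : symmetric e) (e_irr : irreflexive e).
Hypothesis e_reg : forall x y, #|nbhd e x| = #|nbhd e y|.

(** By regularity, either there is no non-edge, and any balanced pairing will do, or every vertex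
    has exactly one non-neighbour, which becomes its partner. *)
Lemma almost_complete_paired :
  (forall x y z, uniq [:: x; y; z] -> e x y || e x z) -> paired e.
Proof.
move=> one_non.
have [e_all|] := boolP [forall x, forall y, (x != y) ==> e x y].
  have [b /swap_involution[s sK bs]] := half_pred cardT.
  exists s, b, true, true, true; split=> // x y xy.
  by rewrite !if_same; move/forallP/(_ x)/forallP/(_ y): e_all; rewrite xy.
rewrite negb_forall => /existsP[x0]; rewrite negb_forall => /existsP[y0].
rewrite negb_imply => /andP[xy0 nxy0].
have ex_non x : exists y, complement e x y.
  have/card_gt0P[y] : 0 < #|nbhd (complement e) x|; last by rewrite inE; exists y.
  have := card_nbhd_complement x e_irr; rewrite (e_reg x x0) -(card_nbhd_complement x0 e_irr).
  move/addnI->; apply/card_gt0P; exists y0; by rewrite inE /complement xy0.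
pose s x := xchoose (ex_non x).
have sP x : complement e x (s x) := xchooseP (ex_non x).
have s_uniq x y : complement e x y -> y = s x.
  move=> exy; apply/eqP; apply: contraT => ys; have /andP[xs nexs] := sP x.
  have /andP[xy nexy] := exy.
  by have := one_non x y (s x); rewrite /= !inE negb_or xy xs ys (negbTE nexs) (negbTE nexy) => /(_ isT).
have sK : involutive s by move=> x; rewrite -(s_uniq (s x) x) // (complement_sym e_sym).
have [b bs] : exists b : pred T, forall x, b (s x) = ~~ b x.
  by apply: involution_orientation => // x; have /andP[] := sP x; rewrite eq_sym.
exists s, b, false, true, true; split=> // x y xy; rewrite if_same.
case: eqP => [->|ys]; first by have /andP[_ /negbTE] := sP x.
by apply: contraT => nexy; case: ys; apply: s_uniq; rewrite /complement xy.
Qed.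

(** Degree plus one is class size plus the number, 0 or 1, of cross edges at the vertex. Without
    cross edges, regularity makes the classes equal in size and any swap will do. The two ends of a
    cross edge also force equal classes; then every vertex has exactly one cross edge, and these
    form the pairing. *)
Lemma two_cliques_paired (b : pred T) : (exists x, b x) -> (exists x, ~~ b x) ->
  (forall x y, x != y -> b x = b y -> e x y) ->
  (forall x y z, y != z -> b x != b y -> b x != b z -> ~~ (e x y && e x z)) ->
  paired e.
Proof.
move=> [x1 bx1] [x0 bx0] in_class cross_uniq.
pose cross x := [set y | (b y != b x) && e x y].
have card_cross x : #|cross x| <= 1.
  apply/card_le1_eqP => z y; rewrite !inE => /andP[bzx exz] /andP[byx exy].
  apply/eqP; apply: contraT => yz.
  by have := cross_uniq x y z yz; rewrite !(eq_sym (b x)) byx bzx exy exz => /(_ isT isT).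
pose class x := [set y | b y == b x].
have deg x : (#|nbhd e x|).+1 = #|class x| + #|cross x|.
  rewrite (cardsD1 x (class x)) inE eqxx add1n addSn; congr _.+1.
  rewrite -(cardsID (class x)); congr (_ + _); apply: eq_card => y; rewrite !inE.
    rewrite andbC; case: (eqVneq (b y) (b x)) => [bxy|]; rewrite ?andbF //= andbT.
    case: (eqVneq y x) => [->|yx]; rewrite ?e_irr //.
    by rewrite in_class // eq_sym.
  by [].
have class_b x : #|class x| = if b x then #|b| else #|predC b|.
  case bx: (b x); apply: eq_card => y; rewrite !inE bx.
    by rewrite eqb_id.
  by rewrite eqbF_neg.
have [/existsP[x /existsP[y /andP[bxy exy]]]|no_cross] :=
    boolP [exists x, exists y, (b y != b x) && e x y]; last first.
  have cross0 x : #|cross x| = 0.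
    apply: eq_card0 => y; rewrite inE; apply: contraNF no_cross => xy.
    by apply/existsP; exists x; apply/existsP; exists y.
  have [s sK bs] : exists2 s : T -> T, involutive s & forall x, b (s x) = ~~ b x.
    apply: swap_involution; have := deg x1; have := deg x0.
    by rewrite (e_reg x0 x1) !cross0 !class_b bx1 (negbTE bx0) => ->; lia.
  exists s, b, false, true, false; split=> // x y xy.
  have [->|ysx] := eqVneq y (s x).
    apply: contraNF no_cross => exs; apply/existsP; exists x; apply/existsP; exists (s x).
    by rewrite exs bs; case: (b x).
  have [bxy|bxy] := eqVneq (b x) (b y); first exact: in_class.
  by apply: contraNF no_cross => exy; apply/existsP; exists x; apply/existsP; exists y; rewrite eq_sym bxy.
have cardb : #|b| = #|predC b|.
  have cross1 u v : b v != b u -> e u v -> #|cross u| = 1.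
    move=> buv euv; apply/eqP; rewrite eqn_leq card_cross; apply/card_gt0P; exists v.
    by rewrite inE buv.
  have := deg x; have := deg y; rewrite (e_reg x y) (cross1 x y) // (cross1 y x) ?[_ == b y]eq_sym ?(e_sym y) //.
  by rewrite !class_b => ->; move: bxy; case: (b x); case: (b y) => // _; lia.
have ex_cross u : exists v, v \in cross u.
  apply/card_gt0P; have := deg u; have := deg x; rewrite (e_reg u x) !class_b cardb !if_same => -> /addnI <-.
  by apply/card_gt0P; exists y; rewrite inE bxy.
pose s u := xchoose (ex_cross u).
have sP u : (b (s u) != b u) && e u (s u) by have := xchooseP (ex_cross u); rewrite inE.
have s_uniq u v : b v != b u -> e u v -> v = s u.
  move=> buv euv; have /andP[bsu esu] := sP u.
  by apply: (card_le1_eqP (card_cross u)); rewrite inE ?bsu ?buv.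
have bs u : b (s u) = ~~ b u by have /andP[] := sP u; case: (b u); case: (b (s u)).
exists s, b, true, true, false; split=> // [u|u v uv].
  by rewrite -(s_uniq (s u) u) // ?bs; [case: (b u) | rewrite e_sym; have /andP[] := sP u].
have [->|vsu] := eqVneq v (s u); first by have /andP[] := sP u.
have [buv|buv] := eqVneq (b u) (b v); first exact: in_class.
by apply: contraNF vsu => euv; apply/eqP; apply: s_uniq; rewrite // eq_sym.
Qed.

Hypotheses (e_oct : octahedral e).

Lemma clique_paired (K : seq T) :
  uniq K -> size K = 5 -> pairwise e K -> paired e.
Proof.
move=> uniq_K sz_K K_clique.
pose b := far e K.
have sh x y z : uniq [:: x; y; z] -> triple_ok e b x y z by exact: clique_triple_ok.
have [/existsP ex_far | /existsP no_far] := boolP [exists x, b x]; last first.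
  have nb x : b x = false by apply/negP => bx; apply: no_far; exists x.
  apply: almost_complete_paired => x y z /sh; rewrite /triple_ok !nb eqxx /= => /andP[+ _].
  by rewrite negb_and !negbK.
(* Take [k] in the clique: its only non-neighbour in [K] is itself, well short of the four that
   [far] asks for. *)
have [k [k' [kk' nbk]]] : exists k k', e k k' /\ ~~ b k.
  case: K uniq_K sz_K K_clique @b {sh ex_far} => [|k [|k' [|c [|d [|f [|]]]]]] //= _ _.
  case/andP => /and5P[ekk' ekc ekd ekf _] _; exists k, k'; split=> //.
  by rewrite /far /= e_irr ekk' ekc ekd ekf.
(* By the last clause of [triple_ok], a far vertex with a far non-neighbour is isolated, whereas [k]
   has the neighbour [k']. *)
have far_clique x y : x != y -> b x -> b y -> e x y.
  move=> xy bx by_; apply: contraT => nexy.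
  have: #|nbhd e x| = 0.
    apply: eq_card0 => z; rewrite inE; have [->|xz] := eqVneq x z; first by rewrite e_irr.
    have [<-|yz] := eqVneq y z; first exact: negbTE.
    have := sh x y z; rewrite /= !inE negb_or xy xz yz => /(_ isT)/and4P[_ _ _].
    by rewrite bx by_ nexy => /negbTE.
  by rewrite (e_reg x k) => /eqP; rewrite cards_eq0 => /eqP/setP/(_ k'); rewrite !inE kk'.
apply: (two_cliques_paired (b := b)) => //; first by exists k.
  move=> x y xy; case bx: (b x) => /esym by_; first exact: far_clique.
  (* A far vertex [z] triggers the third clause, which makes the first class a clique. *)
  have [z bz] := ex_far; have := sh x y z.
  have neqb u v : b u != b v -> u != v by apply: contraNneq => ->.
  rewrite /= !inE negb_or xy !neqb ?bx ?by_ ?bz // => /(_ isT).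
  by rewrite /triple_ok bx by_ bz => /and4P[].
move=> x y z yz bxy bxz; have := sh x y z.
have neqb u v : b u != b v -> u != v by apply: contraNneq => ->.
rewrite /= !inE negb_or yz !neqb // => /(_ isT) /and4P[_ + _ _].
by rewrite bxy; suff -> : b y == b z by []; move: bxy bxz; case: (b x); case: (b y); case: (b z).
Qed.
End Structure.

Lemma octahedral_paired (T : finType) (n : nat) (e : rel T) :
  symmetric e -> irreflexive e -> octahedral e ->
  (forall x y, #|nbhd e x| = #|nbhd e y|) -> #|T| = n.*2 -> 4 < n -> paired e.
Proof.
move=> e_sym e_irr e_oct e_reg cardT lt_n.
have [|K /and3P[uniq_K /eqP sz_K]] := ramsey5 e_sym e_irr e_oct; first by rewrite cardT; lia.
case/orP=> mono_K; first exact: (clique_paired cardT e_sym e_irr e_reg e_oct uniq_K).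
apply: complement_paired.
have c_sym := complement_sym e_sym; have c_irr := complement_irr e.
apply: (clique_paired cardT c_sym c_irr _ (complement_octahedral e_oct) uniq_K sz_K).
  move=> x y; apply: (@addnI #|nbhd e x|).
  by rewrite {2}(e_reg x y) !card_nbhd_complement.
rewrite uniq_pairwise in uniq_K.
have: pairwise (fun x y => (x != y) && ~~ e x y) K by rewrite pairwise_relI uniq_K.
by apply: sub_pairwise.
Qed.

(** * Isomorphic halves of a paired graph *)

Lemma isomorphic_induced (G : sgraph) (A B : {set G}) (f : G -> G) :
  #|A| = #|B| -> {in A, forall x, f x \in B} -> {in A &, injective f} ->
  {in A &, forall x y, adj (f x) (f y) = adj x y} ->
  isomorphic (induced A) (induced B).
Proof.
move=> cardAB fB f_inj f_adj.
pose g (u : induced A) : induced B := exist _ (f (val u)) (fB _ (valP u)).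
exists g; split; last by move=> u v; apply: f_adj; apply: valP.
apply: inj_card_bij; last by rewrite !card_sig cardAB.
by move=> u v /(congr1 val) /= /f_inj fE; apply: val_inj; apply: fE; apply: valP.
Qed.

(* A pair with one vertex on each side is swapped by the pairing, and the pairs
   inside [A] are sent to the equally many pairs inside the complement of [A].
   Every vertex changes its class [b], so adjacency is preserved. *)
Lemma paired_isomorphic (G : sgraph) (A : {set G}) :
  paired (@adj G) -> #|A| = #|~: A| -> isomorphic (induced A) (induced (~: A)).
Proof.
move=> [s [b [p [q [r [sK bs adjE]]]]]] cardA.
pose D := [set x in A | b x && (s x \in A)].
pose Z := [set x in ~: A | b x && (s x \notin A)].
have cardD : #|D| = #|Z|.
  pose N (P : pred G) := #|[set x | P x]|.
  have NE (P Q : pred G) : P =1 Q -> N P = N Q.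
    by move=> PQ; apply: eq_card => x; rewrite !inE PQ.
  have Nsplit (P Q : pred G) : N P = N (predI P Q) + N (predI P (predC Q)).
    rewrite /N -(cardsID [set x | Q x]); congr (_ + _).
      by apply: eq_card => x; rewrite !inE.
    by apply: eq_card => x; rewrite !inE andbC.
  have Ns (P : pred G) : N (P \o s) = N P.
    rewrite /N -(card_imset _ (can_inj sK)); apply: eq_card => x; rewrite inE.
    apply/imsetP/idP => [[y]|Px]; first by rewrite inE => Psy ->.
    by exists (s x); rewrite ?sK // inE /= sK.
  (* Each pair inside [P] contributes two vertices and each split pair one; the last two terms sort
     the split pairs by the side of their [b]-vertex. Complementing [P] exchanges these two terms,
     so equal halves contain equally many pairs. *)
  have half (P : pred G) : N P = (N (predI (predI P b) (P \o s))).*2 +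
      N (predI (predI P b) (predC (P \o s))) + N (predI (predI (predC P) b) (P \o s)).
    rewrite (Nsplit P b) (Nsplit (predI P b) (P \o s)) -(Ns (predI P (predC b))).
    rewrite (Nsplit (predI P (predC b) \o s) P) -addnn -!addnA; congr (_ + _).
    rewrite addnCA; congr (_ + (_ + _)); apply: NE => x /=; rewrite bs negbK;
      by case: (P x); case: (b x); case: (P (s x)).
  have cardN : N (mem A) = N (predC (mem A)).
    by move: cardA; congr (_ = _); apply: eq_card => x; rewrite !inE.
  have DE : #|D| = N (predI (predI (mem A) b) (mem A \o s)).
    by apply: eq_card => x; rewrite !inE /= andbA.
  have ZE : #|Z| = N (predI (predI (predC (mem A)) b) (predC (mem A) \o s)).
    by apply: eq_card => x; rewrite !inE /= andbA.
  move: cardN; rewrite (half (mem A)) (half (predC (mem A))) -DE -ZE -!addnA.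
  rewrite [X in _ = _ + X]addnC.
  rewrite (NE (predI (predI (predC (predC (mem A))) b) (predC (mem A) \o s))
    (predI (predI (mem A) b) (predC (mem A \o s)))); last by move=> x; rewrite /= negbK.
  rewrite (NE (predI (predI (predC (mem A)) b) (predC (predC (mem A) \o s)))
    (predI (predI (predC (mem A)) b) (mem A \o s))); last by move=> x; rewrite /= negbK.
  by move/addIn/double_inj.
pose g x := nth x (enum Z) (index x (enum D)).
have gZ x : x \in D -> g x \in Z.
  by move=> xD; rewrite -mem_enum mem_nth // -cardE -cardD cardE index_mem mem_enum.
have g_inj : {in D &, injective g}.
  move=> x y xD yD; rewrite /g (set_nth_default y) ?(=^~ cardE, index_mem, mem_enum) //.
    move/eqP; rewrite nth_uniq ?enum_uniq -?cardE -?cardD ?cardE ?index_mem ?mem_enum //.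
    by move/eqP; apply: (index_inj x); rewrite mem_enum.
  by rewrite -cardD cardE index_mem mem_enum.
(* [D] and [Z] hold the [b]-vertices of the pairs inside each half. As [g] maps [D] to [Z], the
   extra [s] in the last two cases makes [f] change the class. *)
pose f x := if s x \notin A then s x else if b x then s (g x) else g (s x).
have inZ x : x \in Z = [&& x \notin A, b x & s x \notin A] by rewrite !inE.
have D1 x : x \in A -> s x \in A -> b x -> x \in D by move=> xA sA bx; rewrite inE xA sA bx.
have D2 x : x \in A -> s x \in A -> ~~ b x -> s x \in D.
  by move=> xA sA bx; rewrite inE sK xA sA bs bx.
have fA x : x \in A -> f x \notin A.
  move=> xA; rewrite /f; case: ifP => // /negbFE sxA; case: ifP => bx.
    by have := gZ x (D1 x xA sxA bx); rewrite inZ => /and3P[].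
  by have := gZ _ (D2 x xA sxA (negbT bx)); rewrite inZ => /and3P[].
have sfA x : x \in A -> (s (f x) \in A) = (s x \notin A).
  move=> xA; rewrite /f; case: ifP => [sx|/negbFE sxA]; first by rewrite sK.
  apply/negbTE; case: ifP => bx.
    by have := gZ x (D1 x xA sxA bx); rewrite inZ sK => /and3P[].
  by have := gZ _ (D2 x xA sxA (negbT bx)); rewrite inZ => /and3P[].
have bf x : x \in A -> b (f x) = ~~ b x.
  move=> xA; rewrite /f; case: ifP => [sx|/negbFE sxA]; first by rewrite bs.
  case: ifP => bx.
    by rewrite bs; have := gZ x (D1 x xA sxA bx); rewrite inZ => /and3P[_ ->].
  by have := gZ _ (D2 x xA sxA (negbT bx)); rewrite inZ => /and3P[_ ->].
have fs x : x \in A -> s x \in A -> f (s x) = s (f x).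
  by move=> xA sxA; rewrite /f sK xA sxA /= bs; case: (b x).
have f_inj : {in A &, injective f}.
  move=> x y xA yA fxy; have := sfA x xA; rewrite fxy sfA // => /negb_inj sxy.
  have := bf x xA; rewrite fxy bf // => /negb_inj bxy.
  move: fxy; rewrite /f sxy bxy; case: ifP => [_|/negbFE sxA]; first exact: (can_inj sK).
  have syA : s y \in A by rewrite sxy.
  case: ifP => bx.
    by move/(can_inj sK); apply: g_inj; apply: D1; rewrite // bxy.
  move=> gE; apply: (can_inj sK); apply: g_inj gE; apply: D2; rewrite // ?bxy bx //.
apply: (isomorphic_induced (f := f)) => // [x xA|x y xA yA]; first by rewrite inE fA.
have [->|xy] := eqVneq x y; first by rewrite !adj_irrefl.
have fxy : f x != f y by apply: contra_neq xy; apply: f_inj.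
rewrite !adjE // !bf // (inj_eq negb_inj); congr (if _ then _ else _).
apply/eqP/eqP => [fyE|yE]; last by rewrite yE fs // -yE.
(* By [sfA] this puts [s x] in [A], where [fs] and injectivity of [f] identify it with [y]. *)
have : s (f x) \notin A by rewrite -fyE fA.
rewrite sfA // negbK => sxA.
by apply: f_inj; rewrite ?fs.
Qed.

(** * Third differences of the squared degrees *)

Section Balanced.
Import GRing.Theory.
Local Open Scope ring_scope.

Lemma card_sumz (T : finType) (A : {set T}) : #|A|%:Z = \sum_x (x \in A : nat)%:Z.
Proof.
rewrite -sum1_card big_mkcond (big_morph Posz PoszD (erefl (Posz 0))).
by apply: eq_bigr => x _; case: (x \in A).
Qed.

Lemma sum_degree_sequence (G : sgraph) (A : {set G}) (f : nat -> int) :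
  \sum_(k <- degree_sequence (induced A)) f k =
  \sum_(x in A) f #|[set y in A | adj x y]|.
Proof.
rewrite (perm_big _ (permEl (perm_sort leq _))) big_map big_enum /=.
rewrite (big_sub _ (fun x => f #|[set y in A | adj x y]|)); apply: eq_bigr => u _.
congr f; rewrite /degree -(card_imset _ val_inj); apply: eq_card => y.
rewrite inE; apply/imsetP/andP => [[v]|[yA uy]].
  by rewrite inE => uv ->; split; first exact: (valP v).
by exists (exist _ y yA); rewrite // inE.
Qed.

Variable G : sgraph.

Definition edge (x y : G) : int := (adj x y : nat)%:Z.

Definition nbhd_sum (s : G -> int) (x : G) : int := \sum_y edge x y * s y.

Definition balanced (s : G -> int) : Prop :=
  (forall x, s x = 1 \/ s x = -1) /\ \sum_x s x = 0.

Lemma edge_sym (x y : G) : edge x y = edge y x.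
Proof. by rewrite /edge adj_sym. Qed.

Lemma nbhd_sum1 (x : G) : nbhd_sum (fun=> 1) x = #|nbhd (@adj G) x|%:Z.
Proof. by rewrite card_sumz; apply: eq_bigr => y _; rewrite mulr1 inE. Qed.

Lemma sum_nbhd_sum (s : G -> int) :
  \sum_x nbhd_sum s x = \sum_x s x * nbhd_sum (fun=> 1) x.
Proof.
rewrite exchange_big /=; apply: eq_bigr => y _.
rewrite mulr_sumr; apply: eq_bigr => x _.
by rewrite mulr1 edge_sym mulrC.
Qed.

Hypothesis G_equi : degree_equipartite G.

(* For [A = {x | s x = 1}], the degrees in the two parts are
   [(deg x + S x) / 2] and [(deg x - S x) / 2], where [S = nbhd_sum s]. *)
Lemma balanced_power_sum (s : G -> int) (k : nat) : balanced s ->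
  \sum_x (if s x == 1 then (nbhd_sum (fun=> 1) x + nbhd_sum s x) ^+ k
          else - (nbhd_sum (fun=> 1) x - nbhd_sum s x) ^+ k) = 0.
Proof.
move=> [s_pm s0]; have [n [cardG equi]] := G_equi.
pose A := [set x | s x == 1].
have sE x : s x = 2 * (x \in A : nat)%:Z - 1 by rewrite inE; case: (s_pm x) => ->.
have cardA : #|A| = n.
  move: s0; rewrite (eq_bigr _ (fun x _ => sE x)) sumrB sumr_const !natz -mulr_sumr -card_sumz.
  by move: cardG; rewrite /gorder -[#|G|]/#|xpredT : pred G| => ->; lia.
have degE (B : {set G}) x :
    #|[set y in B | adj x y]|%:Z = \sum_y edge x y * (y \in B : nat)%:Z.
  rewrite card_sumz; apply: eq_bigr => y _.
  by rewrite inE /edge andbC; case: (adj x y); case: (y \in B).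
have degA x : 2 * #|[set y in A | adj x y]|%:Z = nbhd_sum (fun=> 1) x + nbhd_sum s x.
  rewrite degE mulr_sumr -big_split /=; apply: eq_bigr => y _; rewrite sE; ring.
have degC x : 2 * #|[set y in ~: A | adj x y]|%:Z = nbhd_sum (fun=> 1) x - nbhd_sum s x.
  rewrite degE mulr_sumr -sumrB; apply: eq_bigr => y _; rewrite sE inE.
  by case: (y \in A); rewrite /=; ring.
(* Doubling the degrees clears the halves in their formulas. *)
have := congr1 (fun t => \sum_(m <- t) (2 * m%:Z) ^+ k) (equi A cardA).
rewrite !sum_degree_sequence.
under eq_bigr do rewrite degA.
under [in RHS]eq_bigr do rewrite degC.
move/eqP; rewrite -subr_eq0 => /eqP eq0; rewrite -[RHS]eq0 -sumrN.
rewrite (bigID (mem A)) /=; congr (_ + _); apply: eq_big => x; rewrite !inE //.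
  by move->.
by move/negbTE->.
Qed.

(** For [k = 1] the power sum is twice this sum, by [sum_nbhd_sum]. *)
Lemma balanced_degree_sum (s : G -> int) : balanced s ->
  \sum_x s x * nbhd_sum (fun=> 1) x = 0.
Proof.
move=> s_bal; have := balanced_power_sum 1 s_bal.
rewrite (eq_bigr (fun x => s x * nbhd_sum (fun=> 1) x + nbhd_sum s x)); last first.
  by move=> x _; have [/(_ x)[] -> _] := s_bal; rewrite /= !expr1; ring.
by rewrite big_split /= sum_nbhd_sum; move: (\sum_x _) => t; lia.
Qed.

(** For [k = 2] each term expands to [s x * r ^+ 2 + 2 * r * S x + s x * S x ^+ 2], with
    [S = nbhd_sum s]. The first two parts sum to zero, since [s] does and the degree is constant. *)
Lemma balanced_cubic (s : G -> int) (r : int) : balanced s ->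
  (forall x, nbhd_sum (fun=> 1) x = r) -> \sum_x s x * nbhd_sum s x ^+ 2 = 0.
Proof.
move=> s_bal deg_r; have [s_pm s0] := s_bal; have := balanced_power_sum 2 s_bal.
rewrite (eq_bigr (fun x => s x * nbhd_sum s x ^+ 2 + (s x * r ^+ 2 + r *+ 2 * nbhd_sum s x))); last first.
  by move=> x _; rewrite deg_r; case: (s_pm x) => ->; rewrite /=; ring.
rewrite !big_split /= -mulr_suml s0 mul0r add0r -mulr_sumr sum_nbhd_sum.
under [X in _ *+ 2 * X]eq_bigr do rewrite deg_r.
by rewrite -mulr_suml s0 mul0r mulr0 addr0.
Qed.

(** This is the part of a balanced vector outside [X]; opposite signs on pairs of vertices of [X]
    complete it. *)
Lemma half_signs (X : {set G}) : ~~ odd #|~: X| ->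
  exists rho : G -> int, [/\ {in X, forall x, rho x = 0},
    {in ~: X, forall x, rho x = 1 \/ rho x = -1} & \sum_x rho x = 0].
Proof.
move=> even_X; pose m := #|~: X|./2.
pose P := [set x in take m (enum (~: X))]; pose M := [set x in drop m (enum (~: X))].
have cardP : #|P| = m.
  rewrite cardsE; apply: etrans (card_uniqP (take_uniq m (enum_uniq _))) _.
  by rewrite size_takel // -cardE /m; lia.
have cardM : #|M| = m.
  rewrite cardsE; apply: etrans (card_uniqP (drop_uniq m (enum_uniq _))) _.
  by rewrite size_drop -cardE /m; lia.
have PM x : x \in ~: X -> (x \in P) (+) (x \in M).
  rewrite !inE -in_setC -mem_enum -{1}(cat_take_drop m (enum (~: X))) mem_cat.
  have := enum_uniq (mem (~: X)); rewrite -{1}(cat_take_drop m (enum (~: X))) cat_uniq.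
  case/and3P=> _ /hasPn disj _; case xP: (x \in take _ _); case xM: (x \in drop _ _) => //.
  by have := disj x xM; rewrite /= xP.
exists (fun x => (x \in P : nat)%:Z - (x \in M : nat)%:Z); split=> [x xX|x /PM|].
- have out s : subseq s (enum (~: X)) -> x \in s = false.
    by move/mem_subseq => sub; apply: contraTF xX => /sub; rewrite mem_enum inE.
  by rewrite !inE !out ?take_subseq ?drop_subseq.
- by case: (x \in P); case: (x \in M) => // _; [left | right].
by rewrite sumrB -!card_sumz cardP cardM subrr.
Qed.

Lemma sum_delta (a b : G) (F : G -> int) :
  \sum_x F x * ((x == a : nat)%:Z - (x == b : nat)%:Z) = F a - F b.
Proof.
have sum1 c : \sum_x F x * (x == c : nat)%:Z = F c.
  rewrite (bigD1 c) //= eqxx mulr1 big1 ?addr0 // => x /negbTE->; exact: mulr0.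
by under eq_bigr do rewrite mulrBr; rewrite sumrB !sum1.
Qed.

(** Two balanced vectors that differ by exchanging the signs of [x] and [y] have degree sums
    differing by twice the difference of the degrees of [x] and [y]. *)
Lemma equipartite_regular (x y : G) : #|nbhd (@adj G) x| = #|nbhd (@adj G) y|.
Proof.
have [->//|xy] := eqVneq x y.
have [n [cardG _]] := G_equi.
have [rho [rho0 rho_pm rho_sum]] : exists rho : G -> int, [/\ {in [set x; y], forall z, rho z = 0},
    {in ~: [set x; y], forall z, rho z = 1 \/ rho z = -1} & \sum_z rho z = 0].
  apply: half_signs; rewrite cardsCs setCK cards2 xy /=.
  by move: cardG; rewrite /gorder => ->; lia.
pose s t z : int := rho z + t * ((z == x : nat)%:Z - (z == y : nat)%:Z).
have s_bal t : t = 1 \/ t = -1 -> balanced (s t).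
  move=> t_pm; split; last first.
    by rewrite big_split /= rho_sum add0r sum_delta subrr.
  move=> z; rewrite /s.
  have [->|zx] := eqVneq z x.
    by rewrite rho0 ?(negbTE xy) ?inE ?eqxx //; case: t_pm => ->; [left | right].
  have [->|zy] := eqVneq z y.
    by rewrite rho0 ?inE ?eqxx ?orbT //; case: t_pm => ->; [right | left].
  by rewrite mulr0 addr0; apply: rho_pm; rewrite !inE negb_or zx.
have := congr2 (fun u v : int => u - v) (balanced_degree_sum (s_bal 1 (or_introl erefl)))
  (balanced_degree_sum (s_bal (-1) (or_intror erefl))).
rewrite subrr -sumrB.
rewrite (eq_bigr (fun z => (2 * nbhd_sum (fun=> 1) z) * ((z == x : nat)%:Z - (z == y : nat)%:Z))); last first.
  by move=> z _; rewrite /s; ring.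
rewrite sum_delta !nbhd_sum1; lia.
Qed.

(** In the alternating sum over an octahedron the linear terms cancel, since each edge lies in two
    triangles of opposite sign; the products are those of the third difference. *)
Lemma mixedE (a b c : bool) : (mixed a b c : nat)%:Z =
  (a : nat)%:Z + (b : nat)%:Z + (c : nat)%:Z -
  ((a : nat)%:Z * (b : nat)%:Z + (a : nat)%:Z * (c : nat)%:Z + (b : nat)%:Z * (c : nat)%:Z).
Proof. by case: a; case: b; case: c. Qed.

(* The cubic form [\sum_x s x * nbhd_sum s x ^+ 2] vanishes on balanced vectors,
   hence so does its third difference along the three directions that exchange
   [x1] with [y1], [x2] with [y2] and [x3] with [y3]. *)
Lemma equipartite_octahedral : octahedral (@adj G).
Proof.
move=> x1 y1 x2 y2 x3 y3 uniq6; pose X := [set z in [:: x1; y1; x2; y2; x3; y3]].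
have [n [cardG _]] := G_equi.
have [rho [rho0 rho_pm rho_sum]] : exists rho : G -> int, [/\ {in X, forall z, rho z = 0},
    {in ~: X, forall z, rho z = 1 \/ rho z = -1} & \sum_z rho z = 0].
  apply: half_signs; rewrite cardsCs setCK cardsE (card_uniqP uniq6) /=.
  by move: cardG; rewrite /gorder => ->; lia.
pose d (a b z : G) : int := (z == a : nat)%:Z - (z == b : nat)%:Z.
pose s t1 t2 t3 (z : G) : int := rho z + t1 * d x1 y1 z + t2 * d x2 y2 z + t3 * d x3 y3 z.
have s_bal t1 t2 t3 : t1 = 1 \/ t1 = -1 -> t2 = 1 \/ t2 = -1 -> t3 = 1 \/ t3 = -1 ->
    balanced (s t1 t2 t3).
  move=> t1_pm t2_pm t3_pm; split; last first.
    rewrite !big_split /= rho_sum.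
    by rewrite !(sum_delta _ _ (fun=> t1), sum_delta _ _ (fun=> t2), sum_delta _ _ (fun=> t3)) !subrr.
  move=> z; have [zX|zX] := boolP (z \in X); last first.
    have := zX; rewrite !inE !negb_or -?andbA => /and5P[z1 z1' z2 z2' /andP[z3 z3']].
    rewrite /s /d (negbTE z1) (negbTE z1') (negbTE z2) (negbTE z2') (negbTE z3) (negbTE z3').
    by rewrite !mulr0 !addr0; apply: rho_pm; rewrite inE.
  rewrite /s (rho0 z zX) /d; move: zX uniq6; rewrite inE /= !inE !negb_or -?andbA andbT.
  move=> z6; repeat (case/andP=> ?); move=> ?.
  by move: z6; case/or4P=> [/eqP->|/eqP->|/eqP->|/or3P[]/eqP->];
    repeat match goal with H : is_true (?x != ?y) |- _ =>
      rewrite ?(negbTE H) ?[y == x]eq_sym ?(negbTE H); clear H end;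
    rewrite !eqxx /=; lia.
pose D a b x := edge x a - edge x b.
have nbhd_s t1 t2 t3 x : nbhd_sum (s t1 t2 t3) x =
    nbhd_sum rho x + t1 * D x1 y1 x + t2 * D x2 y2 x + t3 * D x3 y3 x.
  rewrite /D -!(sum_delta _ _ (edge x)) !mulr_sumr -!big_split /=.
  by apply: eq_bigr => y _; rewrite /s /d; ring.
have cubic t1 t2 t3 : t1 = 1 \/ t1 = -1 -> t2 = 1 \/ t2 = -1 -> t3 = 1 \/ t3 = -1 ->
    \sum_x s t1 t2 t3 x * nbhd_sum (s t1 t2 t3) x ^+ 2 = 0.
  move=> t1_pm t2_pm t3_pm; apply: (balanced_cubic (s_bal _ _ _ t1_pm t2_pm t3_pm)).
  by move=> x; rewrite nbhd_sum1 (equipartite_regular x x1).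
pose F t1 t2 t3 x := s t1 t2 t3 x * nbhd_sum (s t1 t2 t3) x ^+ 2.
have: \sum_x (F 1 1 1 x - F 1 1 (-1) x - F 1 (-1) 1 x - F (-1) 1 1 x +
    F 1 (-1) (-1) x + F (-1) 1 (-1) x + F (-1) (-1) 1 x - F (-1) (-1) (-1) x) = 0.
  by rewrite !(sumrB, big_split) /= !cubic; try (by left); try (by right).
(* Only the [t1 * t2 * t3] term is odd in all three signs; its coefficient carries a factor 2, and
   the eight sign choices give 16. *)
rewrite (eq_bigr (fun x => 16 * (D x2 y2 x * D x3 y3 x) * d x1 y1 x +
  (16 * (D x1 y1 x * D x3 y3 x) * d x2 y2 x + 16 * (D x1 y1 x * D x2 y2 x) * d x3 y3 x))); last first.
  by move=> x _; rewrite /F !nbhd_s /s; ring.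
rewrite !big_split /= !(sum_delta _ _ (fun x => 16 * (D x2 y2 x * D x3 y3 x)),
  sum_delta _ _ (fun x => 16 * (D x1 y1 x * D x3 y3 x)),
  sum_delta _ _ (fun x => 16 * (D x1 y1 x * D x2 y2 x))) /D.
rewrite (edge_sym x2 x1) (edge_sym x2 y1) (edge_sym y2 x1) (edge_sym y2 y1).
rewrite (edge_sym x3 x1) (edge_sym x3 y1) (edge_sym y3 x1) (edge_sym y3 y1).
rewrite (edge_sym x3 x2) (edge_sym x3 y2) (edge_sym y3 x2) (edge_sym y3 y2).
rewrite /balanced6 => cubic0; rewrite -eqz_nat !PoszD !mixedE -!/(edge _ _).
lia.
Qed.
End Balanced.

(** * Graphs with few vertices, and the theorem *)

Fixpoint all_codes (n : nat) : seq boolmx :=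
  if n is n'.+1 then [seq extend r m | r <- bitseqs n', m <- all_codes n'] else [:: [::]].

Definition code_isomorphic (m1 m2 : boolmx) (p : seq nat) : bool :=
  let s := iota 0 (size m1) in
  all (fun i => all (fun j => entry m2 (nth 0 p i) (nth 0 p j) == entry m1 i j) s) s.

Definition degree_check (n : nat) : bool :=
  all (fun m1 => all (fun m2 =>
    perm_eq (map (count id) m1) (map (count id) m2) ==>
    has (code_isomorphic m1 m2) (permutations (iota 0 n))) (all_codes n)) (all_codes n).

(** Orders 0 to 4 are as far as this goes: the path on five vertices and the disjoint union of a
    triangle and an edge share their degrees. *)
Lemma degree_checkE : all degree_check (iota 0 5).
Proof. by vm_cast_no_check (erefl true). Qed.

Lemma mem_all_codes (T : eqType) (e : rel T) (xs : seq T) :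
  symmetric e -> irreflexive e -> code e xs \in all_codes (size xs).
Proof.
move=> e_sym e_irr; elim: xs => [|x xs IHxs] //.
have := mem_bitseqs [seq e x y | y <- xs]; rewrite size_map code_cons // => r_in.
exact: allpairs_f r_in IHxs.
Qed.

Lemma degrees_code (G : sgraph) :
  map (count id) (code (@adj G) (enum G)) = [seq degree x | x <- enum G].
Proof.
rewrite /code -map_comp; apply: eq_map => x /=.
by rewrite count_map /degree cardsE cardE enumT -size_filter.
Qed.

Lemma degree_sequenceP (G H : sgraph) :
  reflect (degree_sequence G = degree_sequence H)
          (perm_eq [seq degree x | x <- enum G] [seq degree x | x <- enum H]).
Proof. exact: (perm_sortP leq_total leq_trans anti_leq). Qed.

Lemma small_isomorphic (G H : sgraph) :
  #|G| = #|H| -> #|G| <= 4 -> degree_sequence G = degree_sequence H -> isomorphic G H.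
Proof.
move=> cardGH le4 /degree_sequenceP; rewrite -!degrees_code => perm_deg.
have szH : size (enum H) = #|G| by rewrite -cardE cardGH.
have /allP/(_ (code (@adj G) (enum G))) : degree_check #|G|.
  by apply: (allP degree_checkE); rewrite mem_iota.
have mG : code (@adj G) (enum G) \in all_codes #|G|.
  by rewrite [#|G|]cardE mem_all_codes //; [apply: adj_sym | apply: adj_irrefl].
have mH : code (@adj H) (enum H) \in all_codes #|G|.
  by rewrite -szH mem_all_codes //; [apply: adj_sym | apply: adj_irrefl].
move=> /(_ mG)/allP/(_ _ mH); rewrite perm_deg => /hasP[p]; rewrite mem_permutations => perm_p.
rewrite /code_isomorphic size_code -cardE => /allP iso_p.
have size_p : size p = #|G| by rewrite (perm_size perm_p) size_iota.
have uniq_p : uniq p by rewrite (perm_uniq perm_p) iota_uniq.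
have lt_p i : i < #|G| -> nth 0 p i < #|G|.
  by rewrite -{1}size_p => /(mem_nth 0); rewrite (perm_mem perm_p) mem_iota.
have lt_index (x : G) : index x (enum G) < #|G| by rewrite [ltnRHS]cardE index_mem mem_enum.
(* The vertex [y0] serves as default for [nth]; when [H] is empty, so is [G], and the empty map is
   given by hand. *)
have [y0 _|H0] := pickP (@predT H); last first.
  have G0 (x : G) : False by have := lt_index x; rewrite cardGH eq_card0.
  exists (fun x => False_rect _ (G0 x)); split=> [|x]; last by case: (G0 x).
  by exists (fun y => False_rect _ (notF (esym (H0 y)))) => [x|y]; [case: (G0 x) | have := H0 y].
pose f (x : G) := nth y0 (enum H) (nth 0 p (index x (enum G))).
exists f; split=> [|x y].
  apply: inj_card_bij; rewrite ?cardGH // => x y /eqP.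
  rewrite nth_uniq ?enum_uniq ?szH ?lt_p // nth_uniq ?size_p //.
  by move/eqP; apply: (index_inj x); rewrite mem_enum.
have := iso_p (index x (enum G)); rewrite mem_iota lt_index => /(_ isT)/allP.
move=> /(_ (index y (enum G))); rewrite mem_iota lt_index => /(_ isT).
by rewrite (entry_code _ y0) ?szH ?lt_p // (entry_code _ x) -?cardE // !nth_index ?mem_enum // => /eqP.
Qed.

Lemma isomorphic_degree_sequence (G H : sgraph) :
  isomorphic G H -> degree_sequence G = degree_sequence H.
Proof.
move=> [f [f_bij f_adj]]; apply/degree_sequenceP.
have -> : [seq degree x | x <- enum G] = [seq degree y | y <- [seq f x | x <- enum G]].
  rewrite -map_comp; apply: eq_map => x /=; rewrite /degree -(card_imset _ (bij_inj f_bij)).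
  apply: eq_card => y; rewrite inE; have [g fK gK] := f_bij.
  by rewrite -(gK y) f_adj mem_imset ?inE //; apply: bij_inj.
apply: perm_map; apply: uniq_perm; rewrite ?enum_uniq ?(map_inj_uniq (bij_inj f_bij)) ?enum_uniq //.
by move=> y; rewrite mem_enum; have [g fK gK] := f_bij; apply/mapP; exists (g y); rewrite ?mem_enum.
Qed.

Lemma degree_equipartite_isomorphic (G : sgraph) (A : {set G}) :
  degree_equipartite G -> #|A| = #|~: A| -> isomorphic (induced A) (induced (~: A)).
Proof.
move=> G_equi cardA; have [n [cardG equi]] := G_equi.
have cardAn : #|A| = n by have := cardsC A; move: cardG; rewrite /gorder -cardA; lia.
have [le4|lt4] := leqP n 4.
  by apply: small_isomorphic; rewrite ?card_sig -?cardA ?cardAn //; apply: equi.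
apply: paired_isomorphic cardA.
apply: (octahedral_paired (@adj_sym G) (@adj_irrefl G) (equipartite_octahedral G_equi)
  (equipartite_regular G_equi) _ lt4).
by rewrite -mul2n.
Qed.

Theorem theorem4 (G : sgraph) (hG : ~~ odd (gorder G)) :
  degree_equipartite G <-> weakly_equipartite G.
Proof.
split=> [G_equi|[n [cardG iso]]].
  have [n [cardG _]] := G_equi; exists n; split=> // A B AB disj cardA cardB.
  have BE : B = ~: A.
    apply/setP => x; move/setP/(_ x): AB; rewrite !inE.
    by have := disjointFr disj (x := x); case: (x \in A) => [->|] //= _ ->.
  by rewrite BE; apply: degree_equipartite_isomorphic; rewrite // -BE cardA.
exists n; split=> // A cardA; apply: isomorphic_degree_sequence.
apply: iso => //; first exact: setUCr.
  by rewrite -setI_eq0 setICr.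
by move: cardG; rewrite /gorder -(cardsC A) cardA; lia.
Qed.
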